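(* Let $G$ be a connected König–Egerváry graph with $n\ge 2$ vertices. The following are equivalent: (i) $G$ is square-stable; (ii) $G$ has a perfect matching consisting of pendant edges; (iii) $G$ is very well-covered and has exactly $\alpha(G)$ pendant vertices.
   Context: All graphs are finite and simple. A stable set is a set of pairwise non-adjacent vertices; $\alpha(G)$ is the maximum size of a stable set; $\mu(G)$ is the maximum size of a matching. $G$ is a König–Egerváry graph if $\alpha(G)+\mu(G)=|V(G)|$. $G^{2}$ is the graph on $V(G)$ in which distinct $u,v$ are adjacent iff $dist_G(u,v)\le 2$; $G$ is square-stable if $\alpha(G)=\alpha(G^{2})$. A vertex is pendant if it has exactly one neighbour, and an edge incident to a pendant vertex is a pendant edge. $G$ is well-covered if every maximal stable set is a maximum stable set; $G$ is very well-covered if it is well-covered, has no isolated vertices, and $|V(G)|=2\alpha(G)$.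
   Formalization: For n = 2 the graph K_2 satisfies (i) and (ii) but has 2 pendant vertices while α = 1, so (iii) fails; hence (i)/(ii) implies (iii) is stated only for n ≥ 3, while (i) iff (ii) and (iii) implies (ii) are stated for all n ≥ 2. *)

(* Defs.v *)
From mathcomp Require Import all_boot.
Set Implicit Arguments. Unset Strict Implicit. Unset Printing Implicit Defensive.

(* MathComp. A finite simple graph is an adjacency relation [e : rel T] on a
   finType, symmetric and irreflexive; edges are two-element sets of vertices. *)

Section Graphs.
Variables (T : finType) (e : rel T).

Definition simple_graph : Prop := symmetric e /\ irreflexive e.

(* [connect e] relates the endpoints of every walk, so this is connectedness
   up to the empty graph. *)
Definition connected_graph : Prop := forall x y : T, connect e x y.

Definition neighbours (x : T) : {set T} := [set y | e x y].

Definition edges : {set {set T}} :=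
  [set [set p.1; p.2] | p in [pred p : T * T | e p.1 p.2]].

Definition stable (S : {set T}) : bool :=
  [forall x in S, forall y in S, ~~ e x y].

Definition alpha : nat := \max_(S : {set T} | stable S) #|S|.

Definition matching (M : {set {set T}}) : bool :=
  (M \subset edges) && trivIset M.

Definition mu : nat := \max_(M : {set {set T}} | matching M) #|M|.

Definition perfect_matching (M : {set {set T}}) : bool :=
  matching M && (cover M == [set: T]).

Definition konig_egervary : Prop := alpha + mu = #|T|.

Definition walk (k : nat) (u v : T) : bool :=
  [exists p : k.-tuple T, path e u p && (last u p == v)].

(* Least length of a walk from [u] to [v]; a shortest walk has fewer than #|T|
   steps. The value is #|T|, a junk value, if [v] is not reachable from [u]. *)
Definition dist (u v : T) : nat := find (fun k => walk k u v) (iota 0 #|T|).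

(* The [connect] conjunct excludes the junk values of [dist]. *)
Definition square : rel T :=
  fun u v => [&& u != v, connect e u v & dist u v <= 2].

Definition pendant (x : T) : bool := #|neighbours x| == 1.

Definition pendant_edge (f : {set T}) : bool :=
  (f \in edges) && [exists x in f, pendant x].

Definition well_covered : Prop :=
  forall S : {set T}, maxset stable S -> #|S| = alpha.

Definition very_well_covered : Prop :=
  [/\ well_covered, forall x : T, neighbours x != set0 & #|T| = 2 * alpha].

End Graphs.

Definition square_stable (T : finType) (e : rel T) : Prop :=
  alpha e = alpha (square e).

Definition pendant_perfect_matching (T : finType) (e : rel T) : Prop :=
  exists2 M : {set {set T}}, perfect_matching e M &
    forall f : {set T}, f \in M -> pendant_edge e f.

Definition very_well_covered_alpha_pendants (T : finType) (e : rel T) : Prop :=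
  very_well_covered e /\ #|[set x : T | pendant e x]| = alpha e.

(* Main.v *)
Require Import Defs.
From mathcomp Require Import all_boot.
Set Implicit Arguments. Unset Strict Implicit. Unset Printing Implicit Defensive.

(** The whole equivalence is counting against [n = #|T|]. Square-stability says
    that some maximum stable set [S] has pairwise disjoint closed neighbourhoods,
    so choosing a neighbour injects [S] into its complement, while the
    König–Egerváry property gives [n - #|S| = mu <= n / 2]. Hence the choice is a
    bijection onto the complement, every vertex outside [S] has its only
    [S]-neighbour as partner, and every vertex of [S] is pendant. Conversely, a
    perfect matching is a fixed-point-free involution [f]; comparing a set [A]
    with its preimage under [f] shows that [A] has [n / 2] elements as soon as it
    meets every pair [{x, f x}] exactly once. *)

Section GraphLemmas.
Variables (T : finType) (e : rel T).
Hypotheses (e_sym : symmetric e) (e_irr : irreflexive e).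
Implicit Types (x y z : T) (A S : {set T}) (M : {set {set T}}) (f : T -> T).

(** * Edges, stable sets and matchings *)

Lemma edge_neq x y : e x y -> x != y.
Proof. by apply: contraTneq => ->; rewrite e_irr. Qed.

Lemma edgesP (B : {set T}) :
  reflect (exists x y, e x y /\ B = [set x; y]) (B \in edges e).
Proof.
apply: (iffP imsetP) => [[[x y] exy ->]|[x [y [exy ->]]]]; first by exists x, y.
by exists (x, y).
Qed.

Lemma mem_edges x y : ([set x; y] \in edges e) = e x y.
Proof.
apply/edgesP/idP => [[a [b [eab /setP eq_ab]]]|exy]; last by exists x, y.
have := edge_neq eab.
have := eq_ab a; have := eq_ab b; rewrite !inE !eqxx orbT /=.
by case/orP=> /eqP bE /orP[] /eqP aE; move: eab;
  rewrite aE bE ?e_irr ?eqxx // e_sym.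
Qed.

Lemma stableP S : reflect {in S &, forall x y, ~~ e x y} (stable e S).
Proof.
apply: (iffP forall_inP) => [stS x y xS yS | stS x xS].
  by have /forall_inP := stS x xS; apply.
by apply/forall_inP => y yS; apply: stS.
Qed.

Lemma stable_card_alpha S : stable e S -> #|S| <= alpha e.
Proof. exact: (@leq_bigmax_cond _ (stable e) (fun S => #|S|)). Qed.

Lemma alpha_witness : exists2 S, stable e S & #|S| = alpha e.
Proof.
have st0 : 0 < #|stable e|.
  by apply/card_gt0P; exists set0; apply/stableP => x y; rewrite inE.
have [S stS aE] := eq_bigmax_cond (fun S : {set T} => #|S|) st0.
by exists S; [exact: stS | exact: esym aE].
Qed.

Lemma mu_witness : exists2 M, matching e M & #|M| = mu e.
Proof.
have m0 : 0 < #|matching e|.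
  apply/card_gt0P; exists set0; rewrite unfold_in sub0set.
  by apply/trivIsetP => B C; rewrite inE.
have [M mM aE] := eq_bigmax_cond (fun M : {set {set T}} => #|M|) m0.
by exists M; [exact: mM | exact: esym aE].
Qed.

Lemma matching_card_cover M : matching e M -> #|cover M| = 2 * #|M|.
Proof.
case/andP=> /subsetP sME /eqP <-; rewrite mulnC -sum_nat_const.
apply: eq_bigr => B /sME /edgesP[x [y [exy ->]]].
by rewrite cards2 (edge_neq exy).
Qed.

Lemma mu_le_half : 2 * mu e <= #|T|.
Proof.
have [M mM <-] := mu_witness.
by rewrite -(matching_card_cover mM) max_card.
Qed.

(** Disjointness makes the block of [M] at a vertex unique, so the block of [f x] is again
    [[set x; f x]]; hence [f (f x)] is [x] or [f x], and irreflexivity rules out the latter. *)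
Lemma perfect_matching_partner M : perfect_matching e M ->
  exists f, [/\ involutive f, forall x, e x (f x)
              & forall B, B \in M <-> exists x, B = [set x; f x]].
Proof.
case/andP=> /andP[/subsetP sME /trivIsetP tM] /eqP covM.
have exf x : exists y, [set x; y] \in M.
  have : x \in cover M by rewrite covM inE.
  case/bigcupP=> B BM; have /edgesP[a [b [_ BE]]] := sME B BM.
  rewrite BE !inE => /orP[] /eqP->; first by exists b; rewrite -BE.
  by exists a; rewrite setUC -BE.
have [f fM] := fin_all_exists exf.
have ef x : e x (f x) by rewrite -mem_edges sME.
have meet x B : B \in M -> x \in B -> B = [set x; f x].
  move=> BM xB; apply/eqP; apply: contraTT xB => /(tM _ _ BM (fM x)).
  by move/pred0P/(_ x); rewrite /= !inE eqxx andbT => ->.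
exists f; split=> // [x | B].
  have /setP/(_ (f (f x))) := meet (f x) _ (fM x) (set22 _ _).
  rewrite !inE eqxx orbT => /orP[/eqP //|/eqP ffx].
  by have := ef (f x); rewrite ffx e_irr.
split=> [BM | [x ->] //]; have /edgesP[x [y [_ BE]]] := sME B BM.
by exists x; apply: meet; rewrite ?BE ?set21 // -BE.
Qed.

Lemma pendant_neighbour_uniq x y z : pendant e x -> e x y -> e x z -> y = z.
Proof.
case/cards1P=> w /setP Nx exy exz.
have := Nx y; have := Nx z; rewrite !inE exy exz.
by move=> /esym/eqP-> /esym/eqP->.
Qed.

(** * The square of a graph *)

Lemma squareP x y :
  square e x y <-> x != y /\ (e x y \/ exists2 z, e x z & e z y).
Proof.
split=> [/and3P[xNy /connectP[p0 pth_p0 y_p0]] | [xNy exy]].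
  (* A repetition-free path has fewer than [#|T|] steps, so the search in [dist] succeeds and does
     not return its default. *)
  have : has (fun k => walk e k x y) (iota 0 #|T|).
    rewrite y_p0; case: (shortenP pth_p0) => p pth_p uniq_p _.
    apply/hasP; exists (size p).
      by rewrite mem_iota /= add0n; have := card_uniqP uniq_p => /= <-; apply: max_card.
    by apply/existsP; exists (in_tuple p); rewrite pth_p eqxx.
  move=> hasw; have := nth_find 0 hasw; rewrite -/(dist e x y) nth_iota ?add0n; last first.
    by move: hasw; rewrite has_find size_iota.
  case/existsP=> -[p szp] /=; rewrite -(eqP szp) => /andP[pth_p /eqP lst] szp2.
  split=> //; case: p pth_p lst szp2 {szp} => [|a [|b [|//]]] /=.
  - by move=> _ xy; rewrite xy eqxx in xNy.
  - by rewrite andbT => exa <- _; left.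
  - by case/and3P=> exa eab _ <- _; right; exists a.
have walk_dist k : k <= 2 -> walk e k x y -> square e x y.
  move=> k2 wk; rewrite /square xNy /=; apply/andP; split.
    by case/existsP: wk => p /andP[pth /eqP <-]; apply/connectP; exists p.
  (* A walk of length [k < dist e x y] would have been found earlier: [dist] is at most [#|T|], so
     [k] lies in the searched range. *)
  apply: leq_trans k2; rewrite leqNgt; apply/negP => lt_k.
  have := before_find 0 lt_k; rewrite nth_iota ?add0n ?wk //.
  by apply: leq_trans lt_k _; rewrite -[X in _ <= X](size_iota 0); apply: find_size.
case: exy => [exy | [z exz ezy]].
  by apply: (walk_dist 1) => //; apply/existsP; exists [tuple y]; rewrite /= exy eqxx.
by apply: (walk_dist 2) => //; apply/existsP; exists [tuple z; y]; rewrite /= exz ezy eqxx.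
Qed.

Lemma square_stable_stable S : stable (square e) S -> stable e S.
Proof.
move/forall_inP=> stS; apply/stableP => x y xS yS.
have /forall_inP/(_ y yS) := stS x xS; apply: contraNN => exy.
by apply/squareP; split; [apply: edge_neq | left].
Qed.

(** * Counting along a perfect matching *)

Lemma card_preim_involution f A : involutive f -> #|f @^-1: A| = #|A|.
Proof. by move/inv_inj=> injf; rewrite card_preimset. Qed.

(** The preimage of [A] under [f] is its complement, and has as many elements as [A]. *)
Lemma card_half_of_xor f A : involutive f ->
  (forall x, (f x \in A) = (x \notin A)) -> 2 * #|A| = #|T|.
Proof.
move=> invf fA; rewrite -(cardsC A) mul2n -addnn -{2}(@card_preim_involution f) //.
by congr (_ + #|pred_of_set _|); apply/setP => x; rewrite !inE fA.
Qed.

Lemma stable_preim_subset f S : (forall x, e x (f x)) -> stable e S ->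
  f @^-1: S \subset ~: S.
Proof.
move=> ef /stableP stS; apply/subsetP => x; rewrite !inE => fxS.
by apply: contraL (ef x) => xS; apply: stS.
Qed.

Lemma stable_le_half f S : involutive f -> (forall x, e x (f x)) ->
  stable e S -> 2 * #|S| <= #|T|.
Proof.
move=> invf ef stS; rewrite -(cardsC S) mul2n -addnn leq_add2l.
by rewrite -(@card_preim_involution f) // subset_leq_card // stable_preim_subset.
Qed.

Lemma pendant_partner f x y : (forall x, e x (f x)) -> pendant e x -> e x y -> y = f x.
Proof. by move=> ef px exy; apply: pendant_neighbour_uniq px exy (ef x). Qed.

Lemma square_stable_half f : involutive f -> (forall x, e x (f x)) ->
  (forall x, pendant e x || pendant e (f x)) ->
  exists2 S, stable (square e) S & 2 * #|S| = #|T|.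
Proof.
move=> invf ef pf.
(* Breaks the tie when both ends of a matching edge are pendant. *)
pose first x := enum_rank x < enum_rank (f x).
have firstN x : first (f x) = ~~ first x.
  rewrite /first invf -leqNgt ltn_neqAle (inj_eq val_inj) (inj_eq enum_rank_inj).
  by rewrite eq_sym edge_neq.
pose S := [set x | pendant e x && (pendant e (f x) ==> first x)].
have fS x : (f x \in S) = (x \notin S).
  rewrite !inE invf firstN; have := pf x.
  by case: (pendant e x); case: (pendant e (f x)) => //=; case: (first x).
exists S; last exact: card_half_of_xor fS.
have pS x : x \in S -> pendant e x by rewrite inE => /andP[].
apply/forall_inP => x xS; apply/forall_inP => y yS; apply/negP => /squareP[xNy].
(* The only neighbours are [f x] and [f y]: adjacency would put both ends of a pair into [S], and a
   common neighbour would give [f x = f y]. *)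
have px := pendant_partner ef (pS x xS); have py := pendant_partner ef (pS y yS).
case=> [/px yE | [z /px zE]]; first by move: yS; rewrite yE fS xS.
rewrite e_sym => /py; rewrite zE => /(inv_inj invf) xE.
by rewrite xE eqxx in xNy.
Qed.

(** Only its sole neighbour [f x] can keep a pendant [x] out of a maximal stable set. Each pair has
    a pendant end, so [S] meets each pair exactly once. *)
Lemma maximal_stable_half f S : involutive f -> (forall x, e x (f x)) ->
  (forall x, pendant e x || pendant e (f x)) -> maxset (stable e) S ->
  2 * #|S| = #|T|.
Proof.
move=> invf ef pf /maxsetP[stS maxS].
have pS x : pendant e x -> x \notin S -> f x \in S.
  move=> px; apply: contraNT => fxS; suff <- : x |: S = S by rewrite setU11.
  apply: maxS; last exact: subsetUr.
  have xNS z : z \in S -> ~~ e x z.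
    by move=> zS; apply: contraNN fxS => /(pendant_partner ef px) <-.
  apply/stableP => y z; rewrite !inE.
  case/predU1P=> [->|yS] /predU1P[->|zS]; rewrite ?e_irr ?xNS //.
    by rewrite e_sym xNS.
  by move/stableP: stS; apply.
apply: (@card_half_of_xor f) => // x; apply/idP/idP.
  by have /subsetP/(_ x) := stable_preim_subset ef stS; rewrite !inE.
case/orP: (pf x) => [/pS //|pfx].
by apply: contraNT => /(pS _ pfx); rewrite invf.
Qed.

End GraphLemmas.

(** * Connected graphs and the implications *)

Section ConnectedGraphs.
Variables (T : finType) (e : rel T).
Hypotheses (e_sym : symmetric e) (e_irr : irreflexive e).
Hypothesis conn : connected_graph e.

Lemma connected_neighbour (x : T) : 2 <= #|T| -> exists y, e x y.
Proof.
rewrite -cardsT (cardsD1 x) inE ltnS => /card_gt0P[z]; rewrite !inE andbT => zNx.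
have /connectP[[|y p] /= pth zE] := conn x z; first by rewrite zE eqxx in zNx.
by exists y; case/andP: pth.
Qed.

(** Neither end has a further neighbour, so the pair is a whole connected component. *)
Lemma pendant_edge_all (x y : T) :
  e x y -> pendant e x -> pendant e y -> [set x; y] = [set: T].
Proof.
move=> exy px py; apply/setP => z; rewrite [RHS]inE.
have clA : closed e [in [set x; y]].
  apply: intro_closed; first exact: sym_connect_sym.
  move=> a b eab; rewrite !inE => /orP[] /eqP aE; rewrite aE in eab.
    by rewrite (pendant_neighbour_uniq px eab exy) eqxx orbT.
  rewrite e_sym in exy.
  by rewrite (pendant_neighbour_uniq py eab exy) eqxx.
by rewrite -(closed_connect clA (conn x z)) set21.
Qed.

Lemma square_stable_pendant_matching : 2 <= #|T| -> konig_egervary e ->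
  square_stable e -> pendant_perfect_matching e.
Proof.
move=> n2 ke sq.
have [S stS cardS] := alpha_witness (square e).
rewrite -sq in cardS.
have stSe := square_stable_stable e_irr stS.
have [g eg] := fin_all_exists (fun x => connected_neighbour x n2).
have common x y z : x \in S -> y \in S -> e x z -> e y z -> x = y.
  move=> xS yS exz eyz; apply/eqP; have /stableP/(_ x y xS yS) := stS.
  apply: contraNT => xNy; apply/squareP; split=> //.
  by right; exists z; rewrite // e_sym.
have gNS x : x \in S -> g x \notin S.
  move=> xS; apply: contraL (eg x) => gxS.
  by have /stableP := stSe; apply.
(* By [common], [g] is injective on [S]; as [#|~: S| = mu <= #|S|], its image fills the
   complement. *)
have gS : g @: S = ~: S.
  apply/eqP; rewrite eqEcard; apply/andP; split.
    by apply/subsetP => _ /imsetP[x xS ->]; rewrite inE gNS.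
  rewrite card_in_imset; last first.
    by move=> x y xS yS gxy; apply: (common x y (g x)) => //; rewrite gxy eg.
  have mu_leS : mu e <= #|S|.
    by have := mu_le_half e_irr; rewrite -ke -cardS mul2n -addnn leq_add2r.
  by rewrite -(leq_add2l #|S|) cardsC -ke -{1}cardS leq_add2l.
(* A neighbour of [x] lies outside [S], so it is [g z] with [z] in [S]; sharing it forces
   [z = x]. *)
have pS x : x \in S -> pendant e x.
  move=> xS; apply/cards1P; exists (g x); apply/setP => y; rewrite !inE.
  apply/idP/eqP => [exy | ->]; last exact: eg.
  have : y \in g @: S.
    rewrite gS inE; apply: contraL exy => yS.
    by have /stableP := stSe; apply.
  case/imsetP=> z zS yE; rewrite yE in exy *.
  by rewrite (common x z (g z)).
exists [set [set x; g x] | x in S]; last first.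
  move=> _ /imsetP[x xS ->]; rewrite /pendant_edge mem_edges // eg.
  by apply/exists_inP; exists x; rewrite ?set21 ?pS.
rewrite /perfect_matching /matching -andbA; apply/and3P; split.
- by apply/subsetP => _ /imsetP[x xS ->]; rewrite mem_edges.
- apply/trivIsetP => _ _ /imsetP[x xS ->] /imsetP[y yS ->] neq.
  apply/pred0P => z /=; apply: contraNF neq; rewrite !inE.
  case/andP=> /orP[] /eqP-> /orP[] /eqP xy.
  + by rewrite xy.
  + by have := gNS y yS; rewrite -xy xS.
  + by have := gNS x xS; rewrite xy yS.
  + by rewrite (common x y (g x)) // xy.
apply/eqP/setP => x; rewrite [RHS]inE; apply/bigcupP.
have [xS | xNS] := boolP (x \in S).
  by exists [set x; g x]; [apply/imsetP; exists x | exact: set21].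
have : x \in g @: S by rewrite gS inE.
by case/imsetP=> y yS ->; exists [set y; g y]; [apply/imsetP; exists y | exact: set22].
Qed.

Lemma pendant_matching_partner : pendant_perfect_matching e ->
  exists f, [/\ involutive f, forall x, e x (f x)
              & forall x, pendant e x || pendant e (f x)].
Proof.
case=> M /(perfect_matching_partner e_sym e_irr)[f [invf ef Mf]] pM.
exists f; split=> // x; have /pM/andP[_] : [set x; f x] \in M by apply/Mf; exists x.
by case/exists_inP=> y; rewrite !inE => /orP[] /eqP-> ->; rewrite ?orbT.
Qed.

(** Sandwich: [n / 2 <= alpha (square e) <= alpha e <= n / 2], the outer bounds coming from
    [square_stable_half] and [stable_le_half]. *)
Lemma pendant_matching_square_stable :
  pendant_perfect_matching e -> square_stable e /\ #|T| = 2 * alpha e.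
Proof.
case/pendant_matching_partner=> f [invf ef pf].
have [S stS cardS] := square_stable_half e_sym e_irr invf ef pf.
have [A stA cardA] := alpha_witness e.
have [B stB cardB] := alpha_witness (square e).
have le1 := stable_card_alpha stS.
have le2 := stable_card_alpha (square_stable_stable e_irr stB).
have := stable_le_half invf ef stA.
rewrite -cardS leq_pmul2l // cardA => le3; rewrite cardB in le2.
split; first by apply/eqP; rewrite eqn_leq le2 (leq_trans le3).
by congr (2 * _); apply/eqP; rewrite eqn_leq le3 (leq_trans le1).
Qed.

Lemma pendant_matching_alpha_pendants : 2 < #|T| ->
  pendant_perfect_matching e -> very_well_covered_alpha_pendants e.
Proof.
move=> n3 ppm; have [_ cardT] := pendant_matching_square_stable ppm.
have [f [invf ef pf]] := pendant_matching_partner ppm.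
have half m : 2 * m = #|T| -> m = alpha e.
  by move=> mE; apply/eqP; rewrite -(eqn_pmul2l (isT : 0 < 2)) mE cardT.
split; first split=> //.
- by move=> S maxS; apply: half; apply: maximal_stable_half maxS.
- by move=> x; apply/set0Pn; exists (f x); rewrite inE.
(* A pair with two pendant ends would be the whole graph, against [2 < #|T|], so each pair has
   exactly one. *)
apply: half; apply: (card_half_of_xor invf) => // x; rewrite !inE.
have := pf x; case px : (pendant e x) => //= _; apply/negP => pfx.
have := cards2 x (f x); rewrite (pendant_edge_all (ef x) px pfx) cardsT => nE.
by rewrite nE in n3; case: (x != f x) n3.
Qed.

Lemma alpha_pendants_pendant_matching : konig_egervary e ->
  very_well_covered_alpha_pendants e -> pendant_perfect_matching e.
Proof.
move=> ke [[_ _ cardT] cardP].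
have [M mM cardM] := mu_witness e.
(* From [n = 2 * alpha] and [alpha + mu = n] follows [2 * mu = n], so a maximum matching covers
   every vertex. *)
have pM : perfect_matching e M.
  rewrite /perfect_matching mM eqEcard subsetT cardsT (matching_card_cover e_irr mM) cardM.
  by rewrite -(leq_add2l (2 * alpha e)) -mulnDr ke -cardT addnn mul2n leqnn.
exists M => // B BM.
have [f [invf ef Mf]] := perfect_matching_partner e_sym e_irr pM.
case/Mf: (BM) => x BE; rewrite {B}BE in BM *.
rewrite /pendant_edge mem_edges // ef /=; apply/exists_inP.
set P := [set x | pendant e x] in cardP.
suff : (x \in P) || (f x \in P).
  by rewrite !inE => /orP[] ?; [exists x | exists (f x)]; rewrite ?set21 ?set22.
(* A pair with two pendant ends exhausts the graph, so [x] is one of them. *)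
have [/existsP[y /andP[py pfy]] | noP] :=
  boolP [exists y, pendant e y && pendant e (f y)].
  have := in_setT x; rewrite -(pendant_edge_all (ef y) py pfy) !inE.
  by case/orP=> /eqP->; rewrite ?py ?pfy.
(* Now the preimage of [P] avoids [P]; since [#|P| = alpha = n / 2], it is the whole complement. *)
have /eqP fP : f @^-1: P == ~: P.
  rewrite eqEcard; apply/andP; split.
    apply/subsetP => y; rewrite !inE => pfy; apply: contraNN noP => py.
    by apply/existsP; exists y; rewrite py.
  rewrite card_preim_involution // -(leq_add2l #|P|) cardsC cardT cardP.
  by rewrite addnn mul2n.
by have /setP/(_ x) := fP; rewrite !inE => ->; rewrite orbN.
Qed.

End ConnectedGraphs.

(* K_2 satisfies the first two conditions but not the third: both of its vertices
   are pendant while alpha = 1. This is the only exception, so the implication to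
   the third condition (and only that one) carries the guard 2 < #|T|. *)
Theorem theorem2 (T : finType) (e : rel T)
    (simple_e : simple_graph e) (connected_e : connected_graph e)
    (ke_e : konig_egervary e) (n_ge2 : 2 <= #|T|) :
  [/\ square_stable e <-> pendant_perfect_matching e,
      very_well_covered_alpha_pendants e -> pendant_perfect_matching e
    & 2 < #|T| ->
      pendant_perfect_matching e -> very_well_covered_alpha_pendants e].
Proof.
have [e_sym e_irr] := simple_e; split.
- split; first exact: square_stable_pendant_matching.
  by case/(pendant_matching_square_stable e_sym e_irr).
- exact: alpha_pendants_pendant_matching.
- exact: pendant_matching_alpha_pendants.
Qed.
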